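(* There are arbitrarily large finite holey 3-hypertournaments $\mathbf B$ such that $\mathbf B$ has no completion but every proper (induced) substructure of $\mathbf B$ has a completion.
   Context: A 3-hypertournament is a structure $(A,R)$ with a single ternary relation $R$ such that for every 3-element set $S\subseteq A$ the automorphism group of the substructure induced on $S$ is exactly $\mathrm{Alt}(S)$; equivalently, on each 3-set $\{a,b,c\}$ exactly one of $(a,b,c),(a,c,b)$ is in $R$ and $R$ is closed under cyclic rotations. A structure is irreducible if every pair of its vertices lies in some tuple of some relation. A holey 3-hypertournament is a structure $(A,R)$ with one ternary relation such that every irreducible substructure is a 3-hypertournament; a hole is a 3-element set carrying no relation. $\mathbf H_4$ denotes the 3-hypertournament on 4 vertices whose automorphism group is $\mathrm{Alt}(4)$; a 3-hypertournament is $\mathbf H_4$-free if no substructure on 4 vertices is isomorphic to $\mathbf H_4$. A completion of a holey 3-hypertournament $(A,R)$ is a structure $(A,R')$ with $R\subseteq R'$ such that $(A,R')$ is an $\mathbf H_4$-free 3-hypertournament. *)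

(* Defs.v *)
From mathcomp Require Import all_boot all_fingroup.
From mathcomp Require Export alt.

Set Implicit Arguments.
Unset Strict Implicit.
Unset Printing Implicit Defensive.

Definition ternary (T : Type) := T -> T -> T -> bool.

Definition substructure (T : finType) (R : ternary T) (S : {set T}) :
    ternary {x : T | x \in S} :=
  fun x y z => R (val x) (val y) (val z).

Arguments substructure {T} R S _ _ _.

Definition isomorphic (T U : Type) (R : ternary T) (Q : ternary U) : Prop :=
  exists2 f : T -> U, bijective f &
    forall x y z, Q (f x) (f y) (f z) = R x y z.

Definition automorphisms (T : finType) (R : ternary T) : {set {perm T}} :=
  [set s : {perm T} |
    [forall x, forall y, forall z, R (s x) (s y) (s z) == R x y z]].

Definition nondegenerate (T : eqType) (R : ternary T) : Prop :=
  forall x y z, R x y z -> uniq [:: x; y; z].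

(* Without [nondegenerate], tuples with repeated entries such as             *)
(* (a,a,b), (b,b,c), (c,c,a) could alone produce the automorphism group      *)
(* Alt({a,b,c}), and the description in [hypertournamentP] would fail.       *)
Definition hypertournament (T : finType) (R : ternary T) : Prop :=
  nondegenerate R /\
  forall S : {set T}, #|S| = 3 ->
    automorphisms (substructure R S) = ('Alt_{x : T | x \in S})%g.

Definition irreducible (T : eqType) (R : ternary T) : Prop :=
  forall x y : T, x != y ->
    exists a b c : T,
      [/\ R a b c, x \in [:: a; b; c] & y \in [:: a; b; c]].

Definition holey_hypertournament (T : finType) (R : ternary T) : Prop :=
  forall S : {set T},
    irreducible (substructure R S) ->
    hypertournament (substructure R S).

(* The orbit of the triple (0, 1, 2) under Alt(4). That this is the          *)
(* 3-hypertournament on 4 vertices with automorphism group Alt(4), unique    *)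
(* up to isomorphism, is shown by [H4_hypertournament], [automorphisms_H4]   *)
(* and [H4_unique] below.                                                    *)
Definition H4 : ternary 'I_4 := fun i j k =>
  [exists s in ('Alt_'I_4)%g,
    [&& s (inord 0) == i, s (inord 1) == j & s (inord 2) == k]].

Definition H4_free (T : finType) (R : ternary T) : Prop :=
  forall S : {set T}, #|S| = 4 -> ~ isomorphic (substructure R S) H4.

Definition completion (T : finType) (R R' : ternary T) : Prop :=
  [/\ forall x y z, R x y z -> R' x y z, hypertournament R' & H4_free R'].

Definition has_completion (T : finType) (R : ternary T) : Prop :=
  exists R' : ternary T, completion R R'.

Import GroupScope.

Lemma automorphismsP (T : finType) (R : ternary T) (s : {perm T}) :
  reflect (forall x y z, R (s x) (s y) (s z) = R x y z)
          (s \in automorphisms R).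
Proof.
rewrite inE; apply: (iffP forallP) => [h x y z|h x].
  by have /forallP/(_ y)/forallP/(_ z)/eqP := h x.
by apply/forallP=> y; apply/forallP=> z; apply/eqP.
Qed.

Lemma hypertournamentP (T : finType) (R : ternary T) :
  hypertournament R <->
  [/\ nondegenerate R,
      forall x y z, uniq [:: x; y; z] -> R x y z (+) R x z y
    & forall x y z, R x y z -> R y z x].
Proof.
split=> [[ndR altR]|[ndR xorR rotR]].
  have rot x y z : R x y z -> R y z x.
    move=> Rxyz; have := ndR _ _ _ Rxyz.
    rewrite /= !inE negb_or => /and3P[/andP[nxy nxz] nyz _].
    pose S := [set x; y; z].
    have cS : #|S| = 3 by rewrite /S setUC cardsU1 cards2 !inE !(eq_sym z) negb_or nxz nyz nxy.
    have [Sx Sy Sz] : [/\ x \in S, y \in S & z \in S] by rewrite !inE !eqxx ?orbT.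
    pose a : {t | t \in S} := Sub x Sx; pose b : {t | t \in S} := Sub y Sy.
    pose c : {t | t \in S} := Sub z Sz.
    have nab : a != b by [].
    have nac : a != c by [].
    have nbc : b != c by [].
    pose s := tperm a b * tperm a c.
    have : s \in automorphisms (substructure R S).
      by rewrite altR // Alt_even odd_permM !odd_tperm nab nac.
    move=> /automorphismsP/(_ a b c); rewrite !permM tpermL tpermR.
    rewrite (tpermD nac nbc) tpermR tpermL.
    by rewrite tpermD // 1?eq_sym // /substructure /= => ->.
  split=> // x y z.
  rewrite /= !inE negb_or => /and3P[/andP[nxy nxz] nyz _].
  pose S := [set x; y; z].
  have cS : #|S| = 3 by rewrite /S setUC cardsU1 cards2 !inE !(eq_sym z) negb_or nxz nyz nxy.
  have [Sx Sy Sz] : [/\ x \in S, y \in S & z \in S] by rewrite !inE !eqxx ?orbT.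
  pose a : {t | t \in S} := Sub x Sx; pose b : {t | t \in S} := Sub y Sy.
  pose c : {t | t \in S} := Sub z Sz.
  have nab : a != b by [].
  have nac : a != c by [].
  have nbc : b != c by [].
  have rotE u v w : R u v w = R v w u.
    by apply/idP/idP=> [/rot //|/rot/rot].
  have : tperm b c \notin automorphisms (substructure R S).
    by rewrite altR // Alt_even odd_tperm nbc.
  have elt (t : {t | t \in S}) : [\/ t = a, t = b | t = c].
    have: val t \in S by exact: valP.
    rewrite /S !inE -orbA => /or3P[] /eqP tE; [apply: Or31|apply: Or32|apply: Or33];
      exact: val_inj.
  have nd1 u v : R u u v = false by apply/negP=> /ndR; rewrite /= !inE eqxx.
  have nd2 u v : R u v u = false by rewrite -rotE nd1.
  have nd3 u v : R v u u = false by rewrite rotE nd1.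
  apply: contraR; rewrite negb_add => /eqP eqR; apply/automorphismsP=> u v w.
  have ta : tperm b c a = a by rewrite tpermD // eq_sym.
  case: (elt u) (elt v) (elt w) => -> [] -> [] ->;
    rewrite /substructure ?ta ?tpermL ?tpermR /= ?nd1 ?nd2 ?nd3 //;
    first [exact: eqR | exact: esym eqR
          | by rewrite -rotE eqR rotE | by rewrite -rotE -eqR rotE
          | by rewrite rotE eqR -rotE | by rewrite rotE -eqR -rotE
          | by rewrite rotE eqR rotE | by rewrite rotE -eqR rotE
          | by rewrite -rotE eqR -rotE | by rewrite -rotE -eqR -rotE ].
split=> // S cS.
have rotE u v w : R u v w = R v w u.
  by apply/idP/idP=> [/rotR //|/rotR/rotR].
have nd1 u v : R u u v = false by apply/negP=> /ndR; rewrite /= !inE eqxx.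
have nd2 u v : R u v u = false by rewrite -rotE nd1.
have nd3 u v : R v u u = false by rewrite rotE nd1.
have : size (enum S) = 3 by rewrite -cardE.
have := enum_uniq (mem S); have := mem_enum (mem S).
case: (enum S) => [|x [|y [|z []]]] // memS uS _.
have xorS := xorR _ _ _ uS; move: uS.
rewrite /= !inE negb_or => /and3P[/andP[nxy nxz] nyz _].
have [Sx Sy Sz] : [/\ x \in S, y \in S & z \in S].
  by rewrite -!memS !inE !eqxx ?orbT.
pose a : {t | t \in S} := Sub x Sx; pose b : {t | t \in S} := Sub y Sy.
pose c : {t | t \in S} := Sub z Sz.
have nab : a != b by [].
have nac : a != c by [].
have nbc : b != c by [].
have elt (t : {t | t \in S}) : [\/ t = a, t = b | t = c].
  have: val t \in S by exact: valP.
  rewrite -memS !inE => /or3P[] /eqP tE; [apply: Or31|apply: Or32|apply: Or33];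
    exact: val_inj.
have [nba nca ncb] : [/\ b != a, c != a & c != b] by rewrite !(eq_sym c) (eq_sym b).
have eqp (s t : {perm {t | t \in S}}) :
    s a = t a -> s b = t b -> s c = t c -> s = t.
  by move=> sa sb sc; apply/permP=> u; case: (elt u) => ->.
have autS (s : {perm {t | t \in S}}) :
  (s \in automorphisms (substructure R S)) =
  (R (val (s a)) (val (s b)) (val (s c)) == R x y z) &&
  (R (val (s a)) (val (s c)) (val (s b)) == R x z y).
  apply/automorphismsP/andP=> [h|[/eqP h1 /eqP h2] u v w].
    by split; apply/eqP; [exact: (h a b c)|exact: (h a c b)].
  by case: (elt u) (elt v) (elt w) => -> [] -> [] ->;
    rewrite /substructure ?nd1 ?nd2 ?nd3 //=;
    first [exact: h1 | exact: h2 | rewrite !(rotE y); first [exact: h1|exact: h2]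
     | rewrite rotE h1 -rotE | rewrite rotE h2 -rotE
     | rewrite -rotE h1 rotE | rewrite -rotE h2 rotE].
apply/setP=> s; rewrite autS Alt_even.
have injs u v : u != v -> s u != s v by rewrite (inj_eq perm_inj).
have := injs _ _ nab; have := injs _ _ nac; have := injs _ _ nbc.
have ta : tperm b c a = a by rewrite tpermD.
have tb : tperm a c b = b by rewrite tpermD.
have tc : tperm a b c = c by rewrite tpermD.
case: (elt (s a)) (elt (s b)) (elt (s c)) => sa [] sb [] sc;
  rewrite sa sb sc ?eqxx //= => _ _ _.
- have -> : s = 1 by apply: eqp; rewrite ?permE.
  by rewrite odd_perm1.
- have -> : s = tperm b c by apply: eqp; rewrite ?ta ?tpermL ?tpermR.
  by rewrite odd_tperm nbc /=; case: (R x y z) (R x z y) xorS => [] [].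
- have -> : s = tperm a b by apply: eqp; rewrite ?tc ?tpermL ?tpermR.
  rewrite odd_tperm nab /= (rotE y x z) (rotE y z x) (rotE z x y).
  by case: (R x y z) (R x z y) xorS => [] [].
- have -> : s = tperm b c * tperm a b.
    by apply: eqp; rewrite permM ?(ta,tb,tc,tpermL,tpermR).
  rewrite odd_permM !odd_tperm nab nbc /= -(rotE x y z) (rotE y x z).
  by rewrite !eqxx.
- have -> : s = tperm a b * tperm b c.
    by apply: eqp; rewrite permM ?(ta,tb,tc,tpermL,tpermR).
  rewrite odd_permM !odd_tperm nab nbc /= (rotE z x y) -(rotE x z y).
  by rewrite !eqxx.
- have -> : s = tperm a c by apply: eqp; rewrite ?tb ?tpermL ?tpermR.
  rewrite odd_tperm nac /= -(rotE x z y) (rotE z x y).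
  by case: (R x y z) (R x z y) xorS => [] [].
Qed.

Lemma H4P (i j k : 'I_4) :
  reflect (exists s : {perm 'I_4}, [/\ ~~ odd_perm s, s (inord 0) = i,
             s (inord 1) = j & s (inord 2) = k])
          (H4 i j k).
Proof.
apply: (iffP existsP) => [[s /and4P[]]|[s [es si sj sk]]].
  by rewrite Alt_even => es /eqP si /eqP sj /eqP sk; exists s.
by exists s; rewrite Alt_even es si sj sk !eqxx.
Qed.

Lemma ord4_ind (P : 'I_4 -> Prop) :
  P (inord 0) -> P (inord 1) -> P (inord 2) -> P (inord 3) -> forall i, P i.
Proof.
move=> P0 P1 P2 P3 i; rewrite -(inord_val i).
by case: i => [[|[|[|[|]]]]].
Qed.

Lemma inord4_eq m n : m < 4 -> n < 4 ->
  (inord m == inord n :> 'I_4) = (m == n).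
Proof. by move=> hm hn; rewrite -val_eqE /= !inordK. Qed.

Lemma perm4_ext (s t : {perm 'I_4}) :
  s (inord 0) = t (inord 0) -> s (inord 1) = t (inord 1) ->
  s (inord 2) = t (inord 2) -> s = t.
Proof.
move=> e0 e1 e2; suff e3 : s (inord 3) = t (inord 3).
  by apply/permP; apply: ord4_ind.
have := permKV t (s (inord 3)); move: (t^-1 _).
apply: ord4_ind => // e; [move: e0|move: e1|move: e2]; rewrite e => /perm_inj/eqP;
  by rewrite inord4_eq.
Qed.

Lemma perm4_exists (i j k : 'I_4) : uniq [:: i; j; k] ->
  exists s : {perm 'I_4},
    [/\ s (inord 0) = i, s (inord 1) = j & s (inord 2) = k].
Proof.
rewrite /= !inE negb_or => /and3P[/andP[nij nik] njk _].
pose s1 := tperm (inord 0) i.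
pose s2 := s1 * tperm (s1 (inord 1)) j.
have s20 : s2 (inord 0) = i.
  rewrite permM tpermL tpermD // 1?eq_sym //.
  by rewrite -[i in i != _](tpermL (inord 0) i) (inj_eq perm_inj) inord4_eq.
have s21 : s2 (inord 1) = j by rewrite permM tpermL.
have n2i : s2 (inord 2) != i by rewrite -s20 (inj_eq perm_inj) inord4_eq.
have n2j : s2 (inord 2) != j by rewrite -s21 (inj_eq perm_inj) inord4_eq.
exists (s2 * tperm (s2 (inord 2)) k); split; rewrite permM ?tpermL // ?s20 ?s21.
  by rewrite tpermD // eq_sym.
by rewrite tpermD // eq_sym.
Qed.

Lemma H4_hypertournament : hypertournament H4.
Proof.
have n01 : inord 0 != inord 1 :> 'I_4 by rewrite inord4_eq.
have n02 : inord 0 != inord 2 :> 'I_4 by rewrite inord4_eq.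
have n12 : inord 1 != inord 2 :> 'I_4 by rewrite inord4_eq.
apply/hypertournamentP; split.
- move=> i j k /H4P[s [_ <- <- <-]].
  by rewrite /= !inE !(inj_eq perm_inj) (negPf n01) (negPf n02) n12.
- move=> i j k /perm4_exists[s [s0 s1 s2]].
  have t0 : tperm (inord 1) (inord 2) (inord 0 : 'I_4) = inord 0.
    by rewrite tpermD // eq_sym.
  have -> : H4 i j k = ~~ odd_perm s.
    apply/H4P/idP=> [[t [et t0' t1 t2]]|es]; last by exists s.
    by rewrite (_ : s = t) //; apply: perm4_ext; congruence.
  have -> : H4 i k j = odd_perm s.
    apply/H4P/idP=> [[t [et t0' t1 t2]]|os].
      have -> : s = tperm (inord 1) (inord 2) * t.
        by apply: perm4_ext; rewrite permM ?(t0, tpermL, tpermR); congruence.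
      by rewrite odd_permM odd_tperm n12 addTb.
    exists (tperm (inord 1) (inord 2) * s).
    by rewrite odd_permM odd_tperm n12 os !permM ?(t0, tpermL, tpermR).
  by case: odd_perm.
- move=> i j k /H4P[s [es s0 s1 s2]]; apply/H4P.
  exists (tperm (inord 0) (inord 1) * tperm (inord 0) (inord 2) * s).
  rewrite !odd_permM !odd_tperm n01 n02 es !permM ?tpermL ?tpermR.
  by rewrite ?(tpermD n02 n12) ?tpermR ?tpermL tpermD // 1?eq_sym.
Qed.

Lemma automorphisms_H4 : automorphisms H4 = 'Alt_'I_4.
Proof.
have even_H4 (t : {perm 'I_4}) i j k :
    ~~ odd_perm t -> H4 i j k -> H4 (t i) (t j) (t k).
  move=> et /H4P[s [es <- <- <-]]; apply/H4P; exists (s * t).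
  by rewrite odd_permM (negPf es) (negPf et) !permM.
apply/setP=> t; rewrite Alt_even; apply/automorphismsP/idP=> [aut|et i j k].
  have : H4 (inord 0) (inord 1) (inord 2).
    by apply/H4P; exists 1; rewrite odd_perm1 !perm1.
  by rewrite -aut => /H4P[s [es s0 s1 s2]]; rewrite -(perm4_ext s0 s1 s2).
apply/idP/idP; last exact: even_H4.
by move=> /(even_H4 t^-1); rewrite odd_permV !permK; apply.
Qed.

Lemma H4_unique (R : ternary 'I_4) :
  hypertournament R -> automorphisms R = 'Alt_'I_4 -> isomorphic H4 R.
Proof.
move=> htR autR.
have [ndR xorR rotR] := (hypertournamentP R).1 htR.
have [ndH xorH rotH] := (hypertournamentP H4).1 H4_hypertournament.
have evenR (t : {perm 'I_4}) i j k :
    ~~ odd_perm t -> R (t i) (t j) (t k) = R i j k.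
  by rewrite -Alt_even -autR => /automorphismsP.
have [f Rf] : exists f : {perm 'I_4},
    R (f (inord 0)) (f (inord 1)) (f (inord 2)).
  have n12 : inord 1 != inord 2 :> 'I_4 by rewrite inord4_eq.
  have u : uniq [:: inord 0; inord 1; inord 2 : 'I_4].
    by rewrite /= !inE !inord4_eq.
  have := xorR _ _ _ u; case Re: (R _ _ _) => /= h.
    by exists 1; rewrite !perm1.
  exists (tperm (inord 1) (inord 2)).
  by rewrite tpermL tpermR tpermD // eq_sym inord4_eq.
have sub i j k : H4 i j k -> R (f i) (f j) (f k).
  move=> /H4P[s [es <- <- <-]].
  have <- : R ((s ^ f) (f (inord 0))) ((s ^ f) (f (inord 1)))
              ((s ^ f) (f (inord 2))) = R (f (s (inord 0))) (f (s (inord 1)))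
              (f (s (inord 2))) by rewrite !permJ.
  by rewrite evenR // odd_permJ.
exists f => [|i j k]; first by exists (f^-1) => x; rewrite ?permK ?permKV.
apply/idP/idP; last exact: sub.
move=> Rijk; have := ndR _ _ _ Rijk => uf.
have u : uniq [:: i; j; k].
  by rewrite -(map_inj_uniq (@perm_inj _ f)).
have := xorH _ _ _ u; case: (H4 i j k) => //= /sub Rikj.
by have := xorR _ _ _ uf; rewrite Rijk Rikj.
Qed.

(* Main.v *)
Require Import Defs.
From mathcomp Require Import all_boot all_fingroup zify.

(* Some 4-sets act as implications: if (p,q,a) and (q,p,b) are given, then   *)
(* avoiding H4 on {a,b,p,q} means that (a,b,p) implies (a,b,q). Joining two  *)
(* vertices by a path whose consecutive pairs carry such triples transports  *)
(* an implication over any distance. Take vertices 0, 1, 2 and c, and for    *)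
(* every t in {0,1,2} join the other two vertices of the triangle by such    *)
(* paths in both directions, with a = t and b = c. Say that s beats t when   *)
(* (t,c,s) holds: this is a tournament on {0,1,2}, and in a completion the   *)
(* paths force every t to be beaten by both other vertices or by neither,    *)
(* which is absurd.                                                          *)
(*   A small substructure misses an inner vertex of every path. It can then  *)
(* be dismantled by repeatedly removing a vertex v all of whose triples      *)
(* contain a common vertex u, and in the reverse order each v is put back as *)
(* a twin of u. So every minimal non-completable substructure is large.      *)

Set Implicit Arguments.
Unset Strict Implicit.
Unset Printing Implicit Defensive.

Definition pullback (U T : Type) (f : U -> T) (R : ternary T) : ternary U :=
  fun x y z => R (f x) (f y) (f z).

Definition cyclic_closure (T : Type) (R : ternary T) : ternary T :=
  fun x y z => [|| R x y z, R y z x | R z x y].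

Definition partial_hypertournament (T : eqType) (R : ternary T) : Prop :=
  [/\ nondegenerate R, forall x y z, R x y z = R y z x
    & forall x y z, R x y z -> ~~ R x z y].

(* The four triples induce opposite directions on every common pair, as the  *)
(* faces of an oriented tetrahedron do.                                      *)
Definition coherent (T : Type) (R : ternary T) (a b c d : T) : bool :=
  [&& R a b c, R a c d, R a d b & R b d c].

Definition coherent_free (T : Type) (R : ternary T) : Prop :=
  forall a b c d, ~~ coherent R a b c d.

Definition triples_through (T : finType) (R : ternary T) (A : {set T})
    (v u : T) : Prop :=
  {in A &, forall x y, R v x y -> u \in [:: x; y]}.

Lemma rotation_ind (T : eqType) (v : T) (P : T -> T -> T -> Prop) :
  (forall x y z, P x y z -> P y z x) -> (forall y z, P v y z) ->
  forall x y z, v \in [:: x; y; z] -> P x y z.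
Proof.
move=> rotP Pv x y z; rewrite !inE => /or3P[] /eqP <- //; first exact/rotP/rotP.
exact: rotP.
Qed.

Lemma rotation_pair_ind (T : eqType) (u v : T) (P : T -> T -> T -> Prop) :
  u != v -> (forall x y z, P x y z -> P y z x) ->
  (forall w, P u v w) -> (forall w, P v u w) ->
  forall x y z, u \in [:: x; y; z] -> v \in [:: x; y; z] -> P x y z.
Proof.
move=> neq_uv rotP Puv Pvu x y z.
move: x y z; apply: rotation_ind => [x y z IH|y z].
  by move=> yzx_v; apply/rotP/IH; rewrite -(mem_rot 1).
rewrite !inE eq_sym (negPf neq_uv) /= => /orP[] /eqP <- //.
exact/rotP/Pvu.
Qed.

Section CyclicClosure.

Variables (T : eqType) (R : ternary T).

Lemma cyclic_closure_rot x y z :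
  cyclic_closure R x y z = cyclic_closure R y z x.
Proof. by rewrite /cyclic_closure orbC -orbA. Qed.

Lemma cyclic_closure_ind (P : T -> T -> T -> Prop) :
  (forall x y z, P x y z -> P y z x) -> (forall x y z, R x y z -> P x y z) ->
  forall x y z, cyclic_closure R x y z -> P x y z.
Proof. by move=> rotP RP x y z /or3P[/RP|/RP/rotP/rotP|/RP/rotP]. Qed.

Lemma cyclic_closure_nondegenerate :
  nondegenerate R -> nondegenerate (cyclic_closure R).
Proof. by apply: cyclic_closure_ind => x y z; rewrite -(rot_uniq 1). Qed.

End CyclicClosure.

Lemma nondegenerate_pullback (U T : eqType) (f : U -> T) (R : ternary T) :
  nondegenerate R -> nondegenerate (pullback f R).
Proof. by move=> ndR x y z /ndR; apply: (@map_uniq _ _ f [:: x; y; z]). Qed.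

Lemma partial_hypertournament_pullback (U T : eqType) (f : U -> T)
    (R : ternary T) :
  partial_hypertournament R -> partial_hypertournament (pullback f R).
Proof.
move=> [ndR rotR asymR]; split=> [|x y z|x y z]; last exact: asymR.
  exact: nondegenerate_pullback.
exact: rotR.
Qed.

Section Hypertournaments.

Variables (T : finType) (R : ternary T).

Lemma hypertournament_neg x y z :
  hypertournament R -> uniq [:: x; y; z] -> R x z y = ~~ R x y z.
Proof.
by move=> /hypertournamentP[_ xorR _] /xorR; case: (R x y z); case: (R x z y).
Qed.

Lemma hypertournament_partial : hypertournament R -> partial_hypertournament R.
Proof.
move=> htR; have [ndR _ rotR] := (hypertournamentP R).1 htR.
split=> // x y z; first by apply/idP/idP=> [/rotR|/rotR/rotR].
by move=> Rxyz; rewrite (hypertournament_neg htR) ?Rxyz //; apply: ndR.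
Qed.

Lemma partial_hypertournament_total :
  partial_hypertournament R ->
  (forall x y z, uniq [:: x; y; z] -> R x y z || R x z y) ->
  hypertournament R.
Proof.
move=> [ndR rotR asymR] totR; apply/hypertournamentP; split=> // x y z.
  by move=> /totR; case Rxyz: (R x y z) => /=; [rewrite asymR|].
by rewrite rotR.
Qed.

End Hypertournaments.

Lemma hypertournament_pullback (U T : finType) (f : U -> T) (R : ternary T) :
  injective f -> hypertournament R -> hypertournament (pullback f R).
Proof.
move=> fI htR; apply: partial_hypertournament_total => [|x y z].
  exact/partial_hypertournament_pullback/hypertournament_partial.
rewrite -(map_inj_uniq fI) => /(hypertournament_neg htR).
by rewrite /pullback => ->; case: (R _ _ _).
Qed.

Section Coherence.

Variable T : eqType.
Implicit Types (R : ternary T) (a b c d x y z : T).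

Lemma coherent_rot R a b c d :
  partial_hypertournament R -> coherent R a b c d = coherent R a c d b.
Proof.
move=> [_ rotR _]; rewrite /coherent -(rotR c b d).
by case: (R a b c); case: (R a c d); rewrite /= ?andbT ?andbF.
Qed.

Lemma coherent_swap R a b c d :
  partial_hypertournament R -> coherent R a b c d = coherent R b a d c.
Proof.
move=> [_ rotR _]; rewrite /coherent (rotR b a) (rotR a d b) -(rotR a b c).
by case: (R a b c); case: (R a c d); case: (R d b a); case: (R b d c).
Qed.

Lemma coherent_uniq R a b c d :
  nondegenerate R -> coherent R a b c d -> uniq [:: a; b; c; d].
Proof.
move=> ndR /and4P[/ndR + /ndR + /ndR + /ndR]; rewrite /= !inE !negb_or.
move=> /and3P[/andP[-> ->] -> _] /and3P[/andP[_ ->] -> _] _.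
by move=> /and3P[/andP[-> _] _ _].
Qed.

Lemma coherent_front x a b c d : x \in [:: a; b; c; d] ->
  exists b' c' d', perm_eq [:: x; b'; c'; d'] [:: a; b; c; d] /\
    forall R, partial_hypertournament R ->
      coherent R x b' c' d' = coherent R a b c d.
Proof.
rewrite !inE => /or4P[] /eqP->.
- by exists b, c, d.
- exists a, d, c; split=> [|R phR]; last exact/esym/coherent_swap.
  by apply/seq.permP=> p /=; lia.
- exists a, b, d; split=> [|R phR]; first by apply/seq.permP=> p /=; lia.
  by rewrite coherent_swap // -coherent_rot.
- exists a, c, b; split=> [|R phR]; first by apply/seq.permP=> p /=; lia.
  by rewrite coherent_swap // coherent_rot.
Qed.

(* Coherence is invariant under even permutations, and Alt(4) acts           *)
(* transitively on ordered pairs.                                            *)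
Lemma coherent_front2 x y a b c d :
  x != y -> x \in [:: a; b; c; d] -> y \in [:: a; b; c; d] ->
  exists c' d', perm_eq [:: x; y; c'; d'] [:: a; b; c; d] /\
    forall R, partial_hypertournament R ->
      coherent R x y c' d' = coherent R a b c d.
Proof.
move=> neq_xy /coherent_front[b' [c' [d' [perm_x coh_x]]]].
rewrite -(perm_mem perm_x) inE eq_sym (negPf neq_xy) /= !inE.
case/or3P=> /eqP->; [exists c', d'|exists d', b'|exists b', c'];
  (split=> [|R phR]; [apply: perm_trans perm_x; apply/seq.permP=> p /=; lia|]).
- exact: coh_x.
- by rewrite -coherent_rot // coh_x.
- by rewrite coherent_rot // coh_x.
Qed.

Lemma coherent_unique R R' a b c d :
  partial_hypertournament R -> partial_hypertournament R' ->
  coherent R a b c d -> coherent R' a b c d ->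
  {in [:: a; b; c; d] & &, forall x y z, R x y z = R' x y z}.
Proof.
move=> phR phR' cohR cohR' x y z abcd_x abcd_y abcd_z.
have [[ndR _ asymR] [ndR' _ asymR']] := (phR, phR').
have [uxyz|repeated] := boolP (uniq [:: x; y; z]); last first.
  transitivity false; last apply/esym.
    by apply: contraNF repeated; apply: ndR.
  by apply: contraNF repeated; apply: ndR'.
move: uxyz; rewrite /= !inE negb_or => /and3P[/andP[neq_xy neq_xz] neq_yz _].
have [c' [d' [perm_xy coh_xy]]] := coherent_front2 neq_xy abcd_x abcd_y.
have /and4P[Rxyc' _ Rxd'y _] : coherent R x y c' d' by rewrite coh_xy.
have /and4P[R'xyc' _ R'xd'y _] : coherent R' x y c' d' by rewrite coh_xy.
move: abcd_z; rewrite -(perm_mem perm_xy) !inE.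
rewrite (eq_sym z x) (eq_sym z y) (negPf neq_xz) (negPf neq_yz) /=.
case/orP=> /eqP->; first by rewrite Rxyc' R'xyc'.
by rewrite (negPf (asymR _ _ _ Rxd'y)) (negPf (asymR' _ _ _ R'xd'y)).
Qed.

End Coherence.

Lemma H4_three_cycle (i j k l : 'I_4) :
  uniq [:: i; j; k; l] -> H4 l i j -> H4 l j k.
Proof.
rewrite /= !inE !negb_or => /and4P[/and3P[nij nik nil] /andP[njk njl] nkl _].
pose s : {perm 'I_4} := (tperm i j * tperm i k)%g.
have /automorphismsP autH4_s : s \in automorphisms H4.
  by rewrite automorphisms_H4 Alt_even odd_permM !odd_tperm nij nik.
rewrite -autH4_s !permM tpermL tpermR tpermL.
by rewrite (tpermD nil njl) (tpermD nil nkl) tpermD // eq_sym.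
Qed.

Lemma coherent_H4 : coherent H4 (inord 0) (inord 1) (inord 2) (inord 3).
Proof.
have [_ rotH4 _] := hypertournament_partial H4_hypertournament.
have uniq_inord s : uniq s -> all (ltn^~ 4) s ->
    uniq [seq inord i : 'I_4 | i <- s].
  move=> us /allP lt_s4; rewrite map_inj_in_uniq // => m p.
  by move=> /lt_s4 lt_m4 /lt_s4 lt_p4 /eqP; rewrite inord4_eq // => /eqP.
have H012 : H4 (inord 0) (inord 1) (inord 2).
  by apply/H4P; exists 1%g; rewrite odd_perm1 !perm1.
have H023 := H4_three_cycle (uniq_inord [:: 1; 2; 3; 0] isT isT) H012.
have H031 := H4_three_cycle (uniq_inord [:: 2; 3; 1; 0] isT isT) H023.
rewrite /coherent H012 H023 H031 -rotH4.
by apply: (H4_three_cycle (uniq_inord [:: 0; 1; 3; 2] isT isT)); rewrite rotH4.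
Qed.

Lemma coherent_free_H4_free (T : finType) (R : ternary T) :
  coherent_free R -> H4_free R.
Proof.
move=> freeR S _ [f [g _ gK] fE].
have gE i j k : pullback (val \o g) R i j k = H4 i j k.
  by rewrite -{2}(gK i) -{2}(gK j) -{2}(gK k) fE.
suff: coherent (pullback (val \o g) R) (inord 0) (inord 1) (inord 2) (inord 3).
  exact/negP/freeR.
by rewrite /coherent !gE; apply: coherent_H4.
Qed.

Lemma H4_free_coherent_free (T : finType) (R : ternary T) :
  hypertournament R -> H4_free R -> coherent_free R.
Proof.
move=> htR freeR a b c d; apply/negP=> cohR.
have uabcd : uniq [:: a; b; c; d].
  by apply: coherent_uniq cohR; have [] := hypertournament_partial htR.
pose h (i : 'I_4) := nth a [:: a; b; c; d] i.
have hI : injective h by move=> i j /eqP; rewrite nth_uniq // => /eqP/val_inj.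
have hS i : h i \in [set h j | j in 'I_4] by apply: imset_f.
pose g i : {x | x \in [set h j | j in 'I_4]} := Sub (h i) (hS i).
have gI : injective g by move=> i j /(congr1 val)/hI.
have [|f fK gK] := inj_card_bij gI.
  by rewrite card_sig card_imset // card_ord.
apply: (freeR [set h j | j in 'I_4]); first by rewrite card_imset // card_ord.
exists f; first by exists g.
have cohh : coherent (pullback h R) (inord 0) (inord 1) (inord 2) (inord 3).
  by rewrite /coherent /pullback /h !inordK.
have I4 (i : 'I_4) : i \in [:: inord 0; inord 1; inord 2; inord 3].
  by move: i; apply: ord4_ind; rewrite !inE eqxx ?orbT.
have ph4 := hypertournament_partial H4_hypertournament.
have phh := hypertournament_partial (hypertournament_pullback hI htR).
move=> x y z; rewrite (coherent_unique ph4 phh coherent_H4 cohh) //.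
by rewrite -{2}(gK x) -{2}(gK y) -{2}(gK z).
Qed.

Definition completion_on (T : finType) (A : {set T}) (R R' : ternary T) :
    Prop :=
  [/\ hypertournament R', coherent_free R'
    & {in A & &, forall x y z, R x y z -> R' x y z}].

Lemma has_completionP (T : finType) (R : ternary T) :
  has_completion R <-> exists R' : ternary T, completion_on [set: T] R R'.
Proof.
split=> [[R' [RR' htR' freeR']]|[R' [htR' freeR' RR']]]; exists R'; split=> //.
- exact: H4_free_coherent_free.
- by move=> x y z _ _ _; apply: RR'.
- by move=> x y z; apply: RR'.
- exact: coherent_free_H4_free.
Qed.

Lemma completion_on_substructure (T : finType) (R R' : ternary T)
    (S : {set T}) :
  completion_on S R R' -> has_completion (substructure R S).
Proof.
move=> [htR' freeR' RR']; apply/has_completionP; exists (substructure R' S).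
split=> [|a b c d|x y z _ _ _].
- exact: hypertournament_pullback val_inj htR'.
- exact: freeR'.
- by apply: RR'; apply: valP.
Qed.

Lemma has_completion_pullback (U T : finType) (f : U -> T) (R : ternary T) :
  injective f -> has_completion R -> has_completion (pullback f R).
Proof.
move=> fI /has_completionP[R' [htR' freeR' RR']]; apply/has_completionP.
exists (pullback f R'); split=> [|a b c d|x y z _ _ _].
- exact: hypertournament_pullback.
- exact: freeR'.
- by apply: RR'; rewrite inE.
Qed.

Definition completable (T : finType) (R : ternary T) : bool :=
  [exists F : {ffun T * T * T -> bool}, [forall x, forall y, forall z,
    [&& R x y z ==> F (x, y, z), F (x, y, z) ==> uniq [:: x; y; z],
        uniq [:: x; y; z] ==> F (x, y, z) (+) F (x, z, y),
        F (x, y, z) ==> F (y, z, x)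
      & [forall w, ~~ coherent (fun a b c => F (a, b, c)) x y z w]]]].

Lemma completableP (T : finType) (R : ternary T) :
  reflect (has_completion R) (completable R).
Proof.
apply: (iffP existsP) => [[F FP]|/has_completionP[R' [htR' freeR' RR']]].
  have {}FP x y z := forallP (forallP (forallP FP x) y) z.
  apply/has_completionP; exists (fun x y z => F (x, y, z)); split.
  - by apply/hypertournamentP; split=> x y z;
      have /and5P[_ nd xor rot _] := FP x y z;
      [apply: implyP nd|apply: implyP xor|apply: implyP rot].
  - by move=> x y z w; have /and5P[_ _ _ _ /forallP] := FP x y z.
  - by move=> x y z _ _ _; have /and5P[/implyP] := FP x y z.
have /hypertournamentP[ndR' xorR' rotR'] := htR'.
exists [ffun t => R' t.1.1 t.1.2 t.2]; apply/forallP=> x; apply/forallP=> y.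
apply/forallP=> z; rewrite !ffunE /=; apply/and5P; split.
- by apply/implyP/RR'; rewrite inE.
- exact/implyP/ndR'.
- exact/implyP/xorR'.
- exact/implyP/rotR'.
- by apply/forallP=> w; rewrite /coherent !ffunE; apply: freeR'.
Qed.

Section CyclicOrder.

Variables (T : finType) (rank : T -> nat).
Hypothesis rank_inj : injective rank.

Definition cyclic_order : ternary T :=
  cyclic_closure (fun x y z => rank x < rank y < rank z).

Lemma cyclic_order_hypertournament : hypertournament cyclic_order.
Proof.
apply/hypertournamentP; rewrite /cyclic_order /cyclic_closure.
by split=> x y z /=; rewrite ?inE -?(inj_eq rank_inj); lia.
Qed.

Lemma cyclic_order_coherent_free : coherent_free cyclic_order.
Proof.
by move=> a b c d; rewrite /coherent /cyclic_order /cyclic_closure; lia.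
Qed.

End CyclicOrder.

(* The vertex [v] becomes a twin of [u]: it lies in the same triples as [u], *)
(* while [D w] tells whether (v, u, w) or (u, v, w) is a triple.             *)
Section Twins.

Variables (T : finType) (R : ternary T) (u v : T) (D : pred T).
Hypotheses (htR : hypertournament R) (neq_uv : u != v).

Definition merge_twins (x : T) : T := if x == v then u else x.

Definition twin_pair : ternary T := fun x y w =>
  (w \notin [:: u; v]) && ((x, y) == if D w then (v, u) else (u, v)).

Definition twin : ternary T := fun x y z =>
  pullback merge_twins R x y z || cyclic_closure twin_pair x y z.

Definition has_both_twins (s : seq T) : bool := (u \in s) && (v \in s).

Let phR : partial_hypertournament R := hypertournament_partial htR.

Lemma merge_twins_id x : x != v -> merge_twins x = x.
Proof. by rewrite /merge_twins => /negPf->. Qed.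

Lemma twin_pair_has_both x y z : twin_pair x y z -> has_both_twins [:: x; y; z].
Proof.
rewrite /has_both_twins.
by case/andP=> _; case: ifP => _ /eqP[-> ->]; rewrite !inE !eqxx ?orbT.
Qed.

Lemma twin_pair_nondegenerate : nondegenerate twin_pair.
Proof.
move=> x y z /andP[]; rewrite !inE negb_or => /andP[zu zv].
by case: ifP => _ /eqP[-> ->];
  rewrite /= !inE negb_or !(eq_sym _ z) zu zv ?neq_uv // eq_sym neq_uv.
Qed.

Lemma twin_rot x y z : twin x y z = twin y z x.
Proof.
have [_ rotR _] := phR.
by rewrite /twin (cyclic_closure_rot _ x) /pullback (rotR (merge_twins x)).
Qed.

Lemma twin_nondegenerate : nondegenerate twin.
Proof.
have [ndR _ _] := phR; move=> x y z /orP[]; first exact: nondegenerate_pullback.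
exact: cyclic_closure_nondegenerate twin_pair_nondegenerate _ _ _.
Qed.

Lemma twin_apart x y z :
  ~~ has_both_twins [:: x; y; z] ->
  twin x y z = pullback merge_twins R x y z.
Proof.
move=> apart; rewrite /twin [cyclic_closure _ _ _ _]negbTE ?orbF //.
apply: contra apart; move: x y z; apply: cyclic_closure_ind => x y z.
  by rewrite /has_both_twins -!(mem_rot 1 [:: x; y; z]).
exact: twin_pair_has_both.
Qed.

Lemma pullback_merge_twins_uv w :
  pullback merge_twins R u v w = false /\ pullback merge_twins R v u w = false.
Proof.
have [ndR _ _] := phR.
rewrite /pullback /merge_twins eqxx (negPf neq_uv).
by split; apply/negP=> /ndR; rewrite /= !inE eqxx.
Qed.

Lemma twin_vu w : w \notin [:: u; v] -> twin v u w = D w.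
Proof.
move=> uv_w; rewrite /twin (pullback_merge_twins_uv w).2 /cyclic_closure.
rewrite /twin_pair uv_w !inE !eqxx orbT /= orbF.
by case: (D w); rewrite ?eqxx // -pair_eqE /= (negPf neq_uv) andbF.
Qed.

Lemma twin_uv w : w \notin [:: u; v] -> twin u v w = ~~ D w.
Proof.
move=> uv_w; rewrite /twin (pullback_merge_twins_uv w).1 /cyclic_closure.
rewrite /twin_pair uv_w !inE !eqxx orbT /= orbF.
by case: (D w); rewrite ?eqxx // -pair_eqE /= (negPf neq_uv).
Qed.

Lemma uniq_merge_twins s :
  ~~ has_both_twins s -> uniq (map merge_twins s) = uniq s.
Proof.
rewrite /has_both_twins => apart; apply: map_inj_in_uniq => x y sx sy.
rewrite /merge_twins.
by case: eqP => [xv|_]; case: eqP => [yv|_] // xyE; move: apart;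
  rewrite ?xv ?yv //; [rewrite xyE -xv sx sy|rewrite -xyE -yv sx sy].
Qed.

Lemma twin_hypertournament : hypertournament twin.
Proof.
apply/hypertournamentP; split=> [|x y z|x y z]; last by rewrite twin_rot.
  exact: twin_nondegenerate.
have [/andP[su sv]|apart] := boolP (has_both_twins [:: x; y; z]).
  move: x y z su sv; apply: (rotation_pair_ind neq_uv) => [x y z|w|w].
  - rewrite -(rot_uniq 1 [:: x; y; z]) -(twin_rot x y).
    by rewrite (twin_rot y x) (twin_rot x z).
  - rewrite -(rot_uniq 2) => /andP[uv_w _].
    by rewrite (twin_rot u w) (twin_rot w) twin_uv // twin_vu //; case: (D w).
  - rewrite -(rot_uniq 2) => /andP[vu_w _].
    have uv_w : w \notin [:: u; v] by rewrite -(mem_rot 1).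
    by rewrite (twin_rot v w) (twin_rot w) twin_uv // twin_vu //; case: (D w).
move=> uxyz; have apartC : ~~ has_both_twins [:: x; z; y].
  by move: apart; rewrite /has_both_twins !inE ![(_ == y) || _]orbC.
rewrite !twin_apart // /pullback (hypertournament_neg (y := merge_twins y) htR).
  by case: (R _ _ _).
by rewrite -[uniq _]/(uniq (map merge_twins [:: x; y; z])) uniq_merge_twins.
Qed.

(* Coherence gives {c,d} opposite directions from u and from v, while twins  *)
(* induce the same direction on every other pair.                            *)
Lemma twin_incoherent_pair c d : ~~ coherent twin u v c d.
Proof.
have [[_ _ asymR] neq_vu] := (phR, neq_uv); rewrite eq_sym in neq_vu.
apply/negP=> coh; have := coherent_uniq twin_nondegenerate coh.
rewrite /= !inE !negb_or => /and4P[/and3P[_ uc ud] /andP[vc vd] _ _].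
have /and4P[_ twin_ucd _ twin_vdc] := coh; move: twin_ucd twin_vdc.
have [u_vdc v_ucd] : u \notin [:: v; d; c] /\ v \notin [:: u; c; d].
  by rewrite !inE !negb_or neq_uv neq_vu uc ud vc vd.
rewrite !twin_apart /has_both_twins ?(negPf u_vdc) ?(negPf v_ucd) ?andbF //.
rewrite /pullback {4}/merge_twins eqxx !merge_twins_id // 1?eq_sym //.
by move/asymR/negPf->.
Qed.

Lemma twin_coherent_free : coherent_free R -> coherent_free twin.
Proof.
move=> freeR a b c d; apply/negP=> coh.
have [/andP[su sv]|apart] := boolP (has_both_twins [:: a; b; c; d]).
  have [c' [d' [_ coh_uv]]] := coherent_front2 neq_uv su sv.
  have /negP[] := twin_incoherent_pair c' d'.
  by rewrite coh_uv //; apply: hypertournament_partial twin_hypertournament.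
have twinE x y z : all (mem [:: a; b; c; d]) [:: x; y; z] ->
    twin x y z = pullback merge_twins R x y z.
  move=> /allP sub; apply: twin_apart; apply: contra apart.
  by case/andP=> /sub abcd_u /sub abcd_v; apply/andP.
apply: (negP (freeR (merge_twins a) (merge_twins b) (merge_twins c)
  (merge_twins d))).
by move: coh; rewrite /coherent !twinE //= !inE !eqxx ?orbT.
Qed.

End Twins.

Lemma completion_on_twin (T : finType) (R R' : ternary T) (A : {set T})
    (u v : T) :
  partial_hypertournament R -> u != v -> triples_through R A v u ->
  completion_on (A :\ v) R R' -> completion_on A R (twin R' u v (R v u)).
Proof.
move=> [ndR rotR asymR] neq_uv through [htR' freeR' RR'].
split; [exact: twin_hypertournament|exact: twin_coherent_free|move=> x y z].
have [|nv] := boolP (v \in [:: x; y; z]).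
  move: x y z; apply: rotation_ind => [x y z|y z _ Ay Az Rvyz].
    by move=> IH Ay Az Ax; rewrite -rotR -twin_rot //; apply: IH.
  have := ndR _ _ _ Rvyz; move: (through y z Ay Az Rvyz); rewrite !inE.
  case/orP=> /eqP uE; rewrite -{}uE in Rvyz * => uvyz.
    rewrite twin_vu // -(mem_rot 1).
    by move: uvyz; rewrite -(rot_uniq 2) => /andP[].
  rewrite -twin_rot // twin_uv //; first by rewrite asymR // -rotR.
  by move: uvyz; rewrite -(rot_uniq 1) => /andP[].
move=> Ax Ay Az Rxyz; rewrite twin_apart /has_both_twins ?(negPf nv) ?andbF //.
move: nv; rewrite !inE !negb_or !(eq_sym v) => /and3P[xv yv zv].
by rewrite /pullback !merge_twins_id //; apply: RR'; rewrite ?inE ?xv ?yv ?zv.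
Qed.

Definition peelable (T : finType) (R : ternary T) (S : {set T}) : Prop :=
  forall A : {set T}, A \subset S ->
    (exists x y z, [/\ x \in A, y \in A, z \in A & R x y z]) ->
    exists u v, [/\ v \in A, u != v & triples_through R A v u].

Lemma peelable_has_completion (T : finType) (R : ternary T) (S : {set T}) :
  partial_hypertournament R -> peelable R S ->
  has_completion (substructure R S).
Proof.
move=> phR peel; suff [R' complR'] : exists R', completion_on S R R'.
  exact: completion_on_substructure complR'.
have [m] := ubnP #|S|; elim: m S peel => // m IHm A peel ltAm.
have [/'exists_'exists_'exists_and4P[x [y [z Axyz]]]|noR] :=
    boolP [exists x, exists y, exists z,
             [&& x \in A, y \in A, z \in A & R x y z]].
  have [|u [v [Av neq_uv through]]] := peel A (subxx A).
    by exists x, y, z.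
  have [B sBA||R' complR'] := IHm (A :\ v).
  - exact/peel/(subset_trans sBA)/subsetDl.
  - by rewrite (cardsD1 v) Av in ltAm.
  exists (twin R' u v (R v u)); exact: completion_on_twin.
have rankI : injective (fun x : T => enum_rank x : nat).
  by move=> x y /val_inj/enum_rank_inj.
exists (cyclic_order (fun x : T => enum_rank x)).
split=> [||x y z Ax Ay Az Rxyz].
- exact: cyclic_order_hypertournament.
- exact: cyclic_order_coherent_free.
- case/'exists_'exists_existsP: noR; exists x, y, z; exact/and4P.
Qed.

Lemma exists_change (P : pred nat) i j m : i <= m -> j <= m -> P i != P j ->
  exists2 l, l < m & P l != P l.+1.
Proof.
have [/existsP[l Pl] _ _ _|/existsPn constP] :=
    boolP [exists l : 'I_m, P l != P l.+1]; first by exists l.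
suff P0 l : l <= m -> P l = P 0 by move=> le_im le_jm; rewrite !P0 // eqxx.
elim: l => // l IHl lt_lm; rewrite -IHl 1?ltnW //.
exact/esym/eqP/negPn/(constP (Ordinal lt_lm)).
Qed.

(* Every [k] in [K] is a path with n + 1 inner vertices that runs through    *)
(* base vertices only at its ends; [apex k true] and [apex k false] are the  *)
(* vertices a and b of the implications along it.                            *)
Section Chains.

Variables (E K : finType) (source target : K -> E) (apex : K -> bool -> E).
Variable n : nat.
Hypothesis ends_uniq :
  forall k, uniq [:: source k; target k; apex k true; apex k false].

Definition vertex : finType := (E + K * 'I_n.+1)%type.

Implicit Types (k : K) (x y z w : vertex) (A S : {set vertex}).

(* Vertices off the chain get the position [n.+4], adjacent to no position   *)
(* on it.                                                                    *)
Definition pos k x : nat :=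
  match x with
  | inl e => if e == source k then 0 else if e == target k then n.+2 else n.+4
  | inr p => if p.1 == k then p.2.+1 else n.+4
  end.

Local Notation on_chain k x := (pos k x < n.+3).

Definition node k (i : nat) : vertex :=
  if i == 0 then inl (source k)
  else if i == n.+2 then inl (target k)
  else inr (k, inord i.-1).

Definition inner k x : bool := 0 < pos k x < n.+2.

Definition is_apex k x : bool := [exists b, x == inl (apex k b)].

Definition step k x y : bool := pos k y == (pos k x).+1.

Definition link k : ternary vertex := fun x y z =>
  (step k x y && (z == inl (apex k true)))
  || (step k y x && (z == inl (apex k false))).

Definition chains : ternary vertex :=
  fun x y z => [exists k, cyclic_closure (link k) x y z].

Lemma source_target_neq k : source k != target k.
Proof. by have := ends_uniq k; rewrite /= inE negb_or => /andP[/andP[]]. Qed.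

Lemma apex_neq k : apex k true != apex k false.
Proof. by have := ends_uniq k; rewrite /= !inE => /and4P[]. Qed.

Lemma pos_apex k b : pos k (inl (apex k b)) = n.+4.
Proof.
have := ends_uniq k; rewrite /= !inE !negb_or.
case: b => /and4P[/and3P[_ sat saf] /andP[tat taf] _ _];
  by rewrite /= !ifN // eq_sym.
Qed.

Lemma pos_node k i : i < n.+3 -> pos k (node k i) = i.
Proof.
move=> lt_i; rewrite /node.
have [->|i0] := eqVneq i 0; first by rewrite /= eqxx.
have [->|i2] := eqVneq i n.+2.
  by rewrite /= eq_sym (negPf (source_target_neq k)) eqxx.
by rewrite /= eqxx inordK; lia.
Qed.

Lemma node_pos k x : on_chain k x -> node k (pos k x) = x.
Proof.
rewrite /node; case: x => [e|[k' i]] /=.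
  case: eqP => [->//|_]; case: eqP => [->|_]; last by lia.
  by rewrite eqxx.
case: eqP => [->|_]; last by lia.
by rewrite ifN ?inord_val //; have := ltn_ord i; lia.
Qed.

Lemma pos_dichotomy k x : on_chain k x || (pos k x == n.+4).
Proof.
case: x => [e|[k' i]] /=; first by do 2?case: ifP; lia.
by have := ltn_ord i; case: ifP; lia.
Qed.

Lemma pos_is_apex k x : is_apex k x -> pos k x = n.+4.
Proof. by case/existsP=> b /eqP->; apply: pos_apex. Qed.

Lemma inner_base k e : inner k (inl e) = false.
Proof. by rewrite /inner /=; do 2?case: ifP; lia. Qed.

Lemma inner_unique k k' x : inner k x -> on_chain k' x -> k = k'.
Proof.
case: x => [e|[j i]]; first by rewrite inner_base.
by rewrite /inner /=; case: eqP => [->|_]; case: eqP => // _; lia.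
Qed.

Lemma link_pos k x y z : link k x y z ->
  [/\ step k x y || step k y x, on_chain k x, on_chain k y & is_apex k z].
Proof.
have [dx dy] := (pos_dichotomy k x, pos_dichotomy k y).
by case/orP=> /andP[xy /eqP->]; move: xy; rewrite /step => xy;
  split; try (by apply/existsP; eexists; apply: eqxx); lia.
Qed.

Lemma chains_link k x y z : link k x y z -> chains x y z.
Proof. by move=> xyz; apply/existsP; exists k; rewrite /cyclic_closure xyz. Qed.

Lemma chains_rot x y z : chains x y z = chains y z x.
Proof. by apply: eq_existsb => k; apply: cyclic_closure_rot. Qed.

Lemma link_nondegenerate k : nondegenerate (link k).
Proof.
move=> x y z /link_pos[xy px py /pos_is_apex pz].
apply: (@map_uniq _ _ (pos k)).
by move: xy; rewrite /step /= !inE pz; lia.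
Qed.

Lemma link_asym k x y z : link k x y z -> ~~ cyclic_closure (link k) x z y.
Proof.
move=> xyz; have [_ px py /pos_is_apex pz] := link_pos xyz.
apply/negP=> /or3P[/link_pos[]|/link_pos[]|yxz]; try lia.
case/orP: xyz yxz => /andP[xy /eqP->] /orP[] /andP[yx].
- by move: xy yx; rewrite /step; lia.
- by rewrite (inj_eq inl_inj) (negPf (apex_neq k)).
- by rewrite (inj_eq inl_inj) eq_sym (negPf (apex_neq k)).
- by move: xy yx; rewrite /step; lia.
Qed.

Lemma cyclic_link_asym k x y z :
  cyclic_closure (link k) x y z -> ~~ cyclic_closure (link k) x z y.
Proof.
move: x y z; apply: cyclic_closure_ind => x y z; last exact: link_asym.
by rewrite (cyclic_closure_rot _ y).
Qed.

Lemma cyclic_link_inner k x y z : cyclic_closure (link k) x y z ->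
  exists2 w, w \in [:: x; y; z] & inner k w.
Proof.
move: x y z; apply: cyclic_closure_ind => x y z.
  by case=> w xyz_w inner_w; exists w; rewrite // -(mem_rot 1) in xyz_w *.
move=> /link_pos[xy px py _]; have [inner_x|outer_x] := boolP (inner k x).
  by exists x; rewrite // mem_head.
exists y; first by rewrite !inE eqxx orbT.
by move: xy px py outer_x; rewrite /step /inner; lia.
Qed.

Lemma cyclic_link_inner_eq k k' x y z w :
  cyclic_closure (link k) x y z -> w \in [:: x; y; z] -> inner k' w -> k' = k.
Proof.
move: x y z; apply: cyclic_closure_ind => x y z.
  by move=> IH yzx_w; apply: IH; rewrite -(mem_rot 1).
move=> /link_pos[_ px py /existsP[b /eqP->]].
rewrite !inE => /or3P[] /eqP-> inner_w; last by rewrite inner_base in inner_w.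
  exact: inner_unique px.
exact: inner_unique py.
Qed.

Lemma chains_partial : partial_hypertournament chains.
Proof.
split=> [x y z /existsP[k]||x y z /existsP[k kxyz]].
- exact: cyclic_closure_nondegenerate (@link_nondegenerate k) _ _ _.
- exact: chains_rot.
apply/existsP=> -[k' kxzy]; have [w xyz_w inner_w] := cyclic_link_inner kxyz.
have xzy_w : w \in [:: x; z; y].
  by move: xyz_w; rewrite !inE [in X in _ || X]orbC.
have kk' := cyclic_link_inner_eq kxzy xzy_w inner_w; rewrite -kk' in kxzy.
by have /negP := cyclic_link_asym kxyz.
Qed.

Definition linked k x y : bool :=
  [|| step k x y, step k y x, on_chain k x && is_apex k y
    | on_chain k y && is_apex k x].

Lemma linked_sym k x y : linked k x y = linked k y x.
Proof. by rewrite /linked orbCA; congr [|| _, _ | _]; apply: orbC. Qed.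

Lemma cyclic_link_linked k x y z p q : cyclic_closure (link k) x y z ->
  p \in [:: x; y; z] -> q \in [:: x; y; z] -> p != q -> linked k p q.
Proof.
move: x y z; apply: cyclic_closure_ind => x y z.
  by move=> IH yzx_p yzx_q; apply: IH; rewrite -(mem_rot 1).
move=> /link_pos[xy px py pz]; rewrite /linked !inE.
by move=> /or3P[] /eqP-> /or3P[] /eqP->; rewrite ?eqxx // ?px ?py ?pz ?orbT //;
  case/orP: xy => ->; rewrite ?orbT.
Qed.

Lemma linked_apex_chains k x y z : is_apex k z ->
  linked k x y -> linked k x z -> linked k y z -> chains x y z || chains x z y.
Proof.
move=> apex_z xy xz yz; have pz := pos_is_apex apex_z.
have {xy} : step k x y || step k y x.
  have off_apex w : linked k w z -> ~~ is_apex k w.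
    apply: contraL => /pos_is_apex pw; rewrite /linked /step pw pz.
    by rewrite !ltnNge; lia.
  move: xy; rewrite /linked (negPf (off_apex _ xz)) (negPf (off_apex _ yz)).
  by rewrite !andbF !orbF.
rewrite -(chains_rot y); case/existsP: apex_z => b /eqP->.
by move=> /orP[] xy; case: b; apply/orP; [left|right|right|left];
  apply: (@chains_link k); rewrite /link xy !eqxx ?orbT.
Qed.

Lemma linked_chains k x y z :
  linked k x y -> linked k x z -> linked k y z -> chains x y z || chains x z y.
Proof.
move=> xy xz yz.
have [apex_z|nz] := boolP (is_apex k z).
  exact: linked_apex_chains apex_z xy xz yz.
have [apex_y|ny] := boolP (is_apex k y).
  rewrite orbC; apply: linked_apex_chains apex_y xz xy _.
  by rewrite linked_sym.
have [apex_x|nx] := boolP (is_apex k x).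
  rewrite chains_rot -(chains_rot y x).
  by apply: linked_apex_chains apex_x yz _ _; rewrite linked_sym.
move: xy xz yz; rewrite /linked /step (negPf nx) (negPf ny) (negPf nz).
by clear; lia.
Qed.

(* Every triple contains an inner vertex, and an inner vertex lies on a      *)
(* single chain, so all triples of an irreducible substructure lie on the    *)
(* same chain.                                                               *)
Lemma irreducible_linked S p q :
  irreducible (substructure chains S) -> p \in S -> q \in S -> p != q ->
  exists k, {in S &, forall x y, x != y -> linked k x y}.
Proof.
move=> irr Sp Sq neq_pq.
have cover x y : x \in S -> y \in S -> x != y -> exists k w,
    [/\ w \in S, inner k w, linked k x y
      & forall k' z, z \in [:: x; y] -> inner k' z -> k' = k].
  move=> Sx Sy neq_xy.
  have [a [b [c [/existsP[k abc] abc_x abc_y]]]] :=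
    irr (Sub x Sx) (Sub y Sy) neq_xy.
  have [w abc_w inner_w] := cyclic_link_inner abc; exists k, w.
  have [val_x val_y] := (map_f val abc_x, map_f val abc_y).
  split=> // [||k' z xy_z].
  - by case/(mapP (s := [:: a; b; c])): abc_w => t _ ->; apply: valP.
  - exact: cyclic_link_linked abc val_x val_y neq_xy.
  - apply: cyclic_link_inner_eq abc _.
    by move: xy_z; rewrite in_cons mem_seq1 => /orP[] /eqP->.
have [k [w [Sw inner_w _ _]]] := cover p q Sp Sq neq_pq.
exists k => x y Sx Sy neq_xy.
have [k' [w' [Sw' inner_w' linked_xy _]]] := cover x y Sx Sy neq_xy.
suff -> : k = k' by [].
have [ww'|neq_ww'] := eqVneq w w'.
  apply: inner_unique inner_w _; rewrite ww'.
  by case/andP: inner_w' => _; apply: ltnW.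
have [k2 [_ [_ _ _ inner_k2]]] := cover w w' Sw Sw' neq_ww'.
by rewrite (inner_k2 k w) ?mem_head // (inner_k2 k' w') // !inE eqxx orbT.
Qed.

Lemma chains_holey : holey_hypertournament chains.
Proof.
move=> S irr; apply: partial_hypertournament_total => [|x y z].
  exact/partial_hypertournament_pullback/chains_partial.
rewrite /= !inE negb_or => /and3P[/andP[xy xz] yz _].
have [k linked_k] := irreducible_linked irr (valP x) (valP y) xy.
by apply: (@linked_chains k); apply: linked_k => //; apply: valP.
Qed.

Lemma eq_node k i j : i < n.+3 -> j < n.+3 -> (node k i == node k j) = (i == j).
Proof.
move=> lt_i lt_j; apply/eqP/eqP=> [/(congr1 (pos k))|->//].
by rewrite !pos_node.
Qed.

Lemma node_succ_neq k i : i < n.+2 -> node k i != node k i.+1.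
Proof. by move=> lt_i; rewrite eq_node; lia. Qed.

Lemma step_neighbor k i x : i < n.+1 -> on_chain k x ->
  step k (node k i.+1) x || step k x (node k i.+1) ->
  (x == node k i) || (x == node k i.+2).
Proof.
move=> lt_i px; rewrite /step pos_node; last by lia.
by rewrite -(node_pos px) !eq_node ?pos_node; lia.
Qed.

Lemma chains_neighbor k i x y : i < n.+1 -> chains (node k i.+1) x y ->
  (node k i \in [:: x; y]) || (node k i.+2 \in [:: x; y]).
Proof.
move=> lt_i /existsP[k' vxy].
have inner_v : inner k (node k i.+1) by rewrite /inner pos_node; lia.
have kk' := cyclic_link_inner_eq vxy (mem_head _ _) inner_v.
rewrite -{}kk' in vxy.
rewrite !inE ![node k _ == _]eq_sym.
case/or3P: vxy => /link_pos[step_xy px py apex_z].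
- by case/orP: (step_neighbor lt_i py step_xy) => ->; rewrite ?orbT.
- by move: inner_v; rewrite /inner (pos_is_apex apex_z); lia.
- rewrite orbC in step_xy.
  by case/orP: (step_neighbor lt_i px step_xy) => ->; rewrite ?orbT.
Qed.

Lemma triples_through_prev k i A : i < n.+1 -> node k i.+2 \notin A ->
  triples_through chains A (node k i.+1) (node k i).
Proof.
move=> lt_i missing x y Ax Ay /(chains_neighbor lt_i) /orP[//|].
by rewrite !inE => /orP[] /eqP nodeE; rewrite nodeE ?Ax ?Ay in missing.
Qed.

Lemma triples_through_next k i A : i < n.+1 -> node k i \notin A ->
  triples_through chains A (node k i.+1) (node k i.+2).
Proof.
move=> lt_i missing x y Ax Ay /(chains_neighbor lt_i) /orP[|//].
by rewrite !inE => /orP[] /eqP nodeE; rewrite nodeE ?Ax ?Ay in missing.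
Qed.

Lemma missing_inner_node k A :
  #|A| <= n -> exists2 i, i <= n & node k i.+1 \notin A.
Proof.
move=> le_An; have [/existsP[i nAi]|/existsPn allA] :=
    boolP [exists i : 'I_n.+1, node k i.+1 \notin A].
  by exists i; rewrite // -ltnS.
have : #|[set node k i.+1 | i : 'I_n.+1]| <= #|A|.
  apply/subset_leq_card/subsetP=> x /imsetP[i _ ->]; apply/negPn/allA.
rewrite card_imset ?card_ord => [|i j /eqP]; first by rewrite ltnNge le_An.
by rewrite eq_node ?ltnS // 1?ltnW // => /eqP[/val_inj].
Qed.

Lemma chains_peelable S : #|S| <= n -> peelable chains S.
Proof.
move=> le_Sn A sAS [x [y [z [Ax Ay Az /existsP[k xyz]]]]].
have [w xyz_w inner_w] := cyclic_link_inner xyz.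
have Aw : w \in A by move: xyz_w; rewrite !inE => /or3P[] /eqP->.
have le_An : #|A| <= n := leq_trans (subset_leq_card sAS) le_Sn.
have [j le_jn missing_j] := missing_inner_node k le_An.
pose P i := node k i.+1 \in A; have /andP[w_gt0 lt_wn] := inner_w.
have Pw : P (pos k w).-1 by rewrite /P prednK // node_pos // ltnW.
have [m lt_mn] : exists2 m, m < n & P m != P m.+1.
  apply: (@exists_change P (pos k w).-1 j) => //; first by rewrite -ltnS prednK.
  by rewrite Pw /P (negPf missing_j).
rewrite /P; have [Am missing|missing] := boolP (node k m.+1 \in A).
  exists (node k m), (node k m.+1); split=> //.
    by apply: node_succ_neq; rewrite ltnS ltnW // ltnW.
  by apply: triples_through_prev; [apply: ltnW|apply: contra missing => ->].
rewrite eq_sym eqbF_neg negbK => Am.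
exists (node k m.+3), (node k m.+2); split=> //.
  by rewrite eq_sym node_succ_neq.
exact: triples_through_next.
Qed.

Lemma chains_completion_step (R' : ternary vertex) k x y :
  completion_on setT chains R' -> step k x y ->
  R' (inl (apex k true)) (inl (apex k false)) x ->
  R' (inl (apex k true)) (inl (apex k false)) y.
Proof.
move=> [htR' freeR' RR']; set a : vertex := inl _; set b : vertex := inl _.
move=> sxy Rabx; have [_ rotR' _] := hypertournament_partial htR'.
have Rxya : R' x y a.
  apply: RR'; rewrite ?inE //.
  by apply: (@chains_link k); rewrite /link sxy eqxx.
have Ryxb : R' y x b.
  apply: RR'; rewrite ?inE //.
  by apply: (@chains_link k); rewrite /link sxy eqxx orbT.
have := freeR' a b x y.
rewrite /coherent Rabx (rotR' a x) Rxya (rotR' b y) Ryxb /= andbT => nRayb.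
suff uaby : uniq [:: a; b; y].
  by rewrite -[R' a b y]negbK -(hypertournament_neg htR' uaby).
have apex_neq_y i : inl (apex k i) != y.
  apply: contraTneq sxy => <-; have := pos_dichotomy k x.
  by rewrite /step pos_apex; lia.
by rewrite /= !inE negb_or !apex_neq_y (inj_eq inl_inj) apex_neq.
Qed.

Lemma chains_completion_implication (R' : ternary vertex) k :
  completion_on setT chains R' ->
  R' (inl (apex k true)) (inl (apex k false)) (inl (source k)) ->
  R' (inl (apex k true)) (inl (apex k false)) (inl (target k)).
Proof.
move=> complR' Rsource.
have -> : inl (target k) = node k n.+2 by rewrite /node eqxx.
have : n.+2 < n.+3 by []; elim: {1 3}n.+2 => [|i IHi] lt_i.
  by rewrite /node.
apply: (chains_completion_step complR' _ (IHi (ltnW lt_i))).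
by rewrite /step !pos_node // ltnW.
Qed.

End Chains.

Section Image.

Variables (U T : finType) (f : U -> T) (R : ternary T).
Hypothesis f_inj : injective f.

Definition to_image (x : U) : {y | y \in f @: setT} :=
  Sub (f x) (imset_f f (in_setT x)).

Lemma to_image_inj : injective to_image.
Proof. by move=> x y /(congr1 val) /f_inj. Qed.

Lemma to_image_surj y : exists x, y = to_image x.
Proof.
by case: y => y im_y; have /imsetP[x _ yE] := im_y; exists x; apply: val_inj.
Qed.

Lemma irreducible_image :
  irreducible (pullback f R) -> irreducible (substructure R (f @: setT)).
Proof.
move=> irr y y'; have [[x ->] [x' ->]] := (to_image_surj y, to_image_surj y').
rewrite (inj_eq to_image_inj) => /irr[a [b [c [Rabc abc_x abc_x']]]].
exists (to_image a), (to_image b), (to_image c).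
by split=> //; apply: (map_f to_image (s := [:: a; b; c])).
Qed.

Lemma has_completion_image :
  has_completion (substructure R (f @: setT)) -> has_completion (pullback f R).
Proof. exact: has_completion_pullback to_image_inj. Qed.

Lemma hypertournament_image :
  hypertournament (substructure R (f @: setT)) ->
  hypertournament (pullback f R).
Proof. exact: hypertournament_pullback to_image_inj. Qed.

End Image.

Lemma holey_hypertournament_pullback (U T : finType) (f : U -> T)
    (R : ternary T) :
  injective f -> holey_hypertournament R ->
  holey_hypertournament (pullback f R).
Proof.
move=> f_inj holeyR S irr.
have fS_inj := inj_comp f_inj (@val_inj _ _ {x | x \in S}).
exact/(hypertournament_image fS_inj)/holeyR/(irreducible_image fS_inj).
Qed.

Definition critical (T : finType) (R : ternary T) : Prop :=
  ~ has_completion R /\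
  forall S : {set T}, S \proper [set: T] -> has_completion (substructure R S).

Lemma critical_substructure (T : finType) (R : ternary T) :
  ~ has_completion R -> exists S : {set T}, critical (substructure R S).
Proof.
move=> ncR.
have [|S /minsetP[/completableP ncS minS] _] :=
    @minset_exists _ (fun S => ~~ completable (substructure R S)) setT.
  apply/completableP=> cT; apply: ncR.
  pose f x : {x | x \in [set: T]} := Sub x (in_setT x).
  by apply: (has_completion_pullback (f := f)) cT => x y [].
exists S; split=> // S' ltS'.
pose f (x : {x | x \in S'}) := val (val x).
have f_inj : injective f by apply: inj_comp val_inj val_inj.
apply: (has_completion_image f_inj); apply/completableP.
apply: contraTT ltS' => nc_im; apply/negP=> /proper_card.
have imE : f @: setT = S.
  by apply: minS nc_im _; apply/subsetP=> _ /imsetP[x _ ->]; apply: valP.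
have := card_imset setT f_inj.
by rewrite imE !cardsT !card_sig => ->; rewrite ltnn.
Qed.

(* [Some t] are the vertices 0, 1, 2 and [None] is c. *)
Definition triangle_source (k : 'I_3 * bool) : option 'I_3 :=
  Some (if k.2 then ordS k.1 else ord_pred k.1).

Definition triangle_target (k : 'I_3 * bool) : option 'I_3 :=
  Some (if k.2 then ord_pred k.1 else ordS k.1).

Definition triangle_apex (k : 'I_3 * bool) (b : bool) : option 'I_3 :=
  if b then Some k.1 else None.

Lemma triangle_ends_uniq (k : 'I_3 * bool) :
  uniq [:: triangle_source k; triangle_target k; triangle_apex k true;
           triangle_apex k false].
Proof. by case: k => [[[|[|[|m]]] ?] []]. Qed.

Definition triangle_chains (n : nat) :
    ternary (vertex (option 'I_3) ('I_3 * bool)%type n) :=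
  @chains _ _ triangle_source triangle_target triangle_apex n.

Arguments triangle_chains n _ _ _ : clear implicits.

Lemma triangle_chains_incompletable (n : nat) :
  ~ has_completion (triangle_chains n).
Proof.
move=> /has_completionP[R' complR']; have [htR' _ _] := complR'.
have [_ rotR' _] := hypertournament_partial htR'.
pose beats (s t : 'I_3) := R' (inl (Some t)) (inl None) (inl (Some s)).
have beats_balanced t : beats (ordS t) t = beats (ord_pred t) t.
  have implication b :=
    chains_completion_implication triangle_ends_uniq (k := (t, b)) complR'.
  by apply/idP/idP; [exact: (implication true)|exact: (implication false)].
have beats_tournament s t : s != t -> beats t s = ~~ beats s t.
  move=> neq_st; rewrite /beats (rotR' (inl (Some s))) (rotR' (inl None)).
  rewrite (hypertournament_neg htR') //= !inE andbT.
  by apply: contraNneq neq_st => -[->].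
have ordS3 (t : 'I_3) : ordS (ordS (ordS t)) = t.
  by case: t => [[|[|[|]]]] // ?; apply: val_inj.
pose t1 : 'I_3 := ordS ord0; pose t2 : 'I_3 := ordS t1.
move: (beats_balanced ord0) (beats_balanced t1) (beats_balanced t2).
rewrite -[in ord_pred ord0](ordS3 ord0) !ordSK -/t1 -/t2 [ordS t2]ordS3.
rewrite (beats_tournament ord0 t1) // (beats_tournament ord0 t2) //.
by rewrite (beats_tournament t1 t2) //; do 3 case: (beats _ _).
Qed.

Theorem theorem2 (n : nat) :
  exists (B : finType) (R : ternary B),
    [/\ n <= #|B|,
        holey_hypertournament R,
        ~ has_completion R
      & forall S : {set B}, S \proper [set: B] ->
          has_completion (substructure R S)].
Proof.
have [S [ncS properS]] :=
  critical_substructure (@triangle_chains_incompletable n).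
exists {x | x \in S}, (substructure (triangle_chains n) S); split=> //.
- rewrite card_sig leqNgt; apply/negP=> /ltnW le_Sn; apply: ncS.
  apply: peelable_has_completion.
    exact: chains_partial triangle_ends_uniq.
  exact: chains_peelable triangle_ends_uniq _ le_Sn.
- apply: holey_hypertournament_pullback val_inj _.
  exact: chains_holey triangle_ends_uniq.
Qed.
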